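(* Let $P$ be a finite poset with minimum $\hat 0$ and let $\phi:\phi(0)=\hat 0<\phi(1)<\dots<\phi(n-1)$ be a chain in $P$. Then the lattice $\mathrm{Tam}(P,\phi)$ is left modular. Furthermore, let $\mathcal L: x_1\succ x_2\succ\dots\succ x_N$ (with $N=|\mathcal C_P^\phi|$) be a linear extension of $(\mathcal C_P^\phi,\le_{prod})$ such that (i) $(x,j)\succ(y,i)$ for all $(x,j),(y,i)\in\mathcal C_P^\phi$ with $j>i$; and (ii) for all $k<n$, all $(x,k)\in\mathcal C_k$ and all $0\le i\le k$, if $(x,k)\not\le a_{i,k}$ then $(x,k)\succ a_{i,k}$. Then the edge-labelling $\omega_{\mathcal L}$ is an $EL$-labelling of $\mathrm{Tam}(P,\phi)$ such that any interval has at most one decreasing maximal chain. Thus for all intervals $[x,y]$ of $\mathrm{Tam}(P,\phi)$ the Möbius function satisfies $\mu(x,y)\in\{-1,0,1\}$.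
   Context: For $x\in P$, $I_P(x)=\{y\in P\mid y\le x\}$. For $0\le k<n$ let $\mathcal C_k:=I_P(\phi(k))\times\{k\}$, and let $\mathcal C_P^\phi:=\bigsqcup_{k<n}\mathcal C_k$ be the disjoint union of posets, i.e. $(x,i)\le(y,j)$ iff $i=j$ and $x\le y$ in $P$. An order filter of $\mathcal C_P^\phi$ is an up-closed subset for this order. An order filter $F$ of $\mathcal C_P^\phi$ is torclosed if for all $i<j<n$: $(x,i)\in F$ and $(\phi(i+1),j)\in F$ imply $(x,j)\in F$. $\mathrm{Tam}(P,\phi)$ is the set of torclosed subsets of $\mathcal C_P^\phi$ ordered by inclusion; it is a finite lattice whose meet is intersection. On the set $\mathcal C_P^\phi$ the product order is: $(x,i)\le_{prod}(y,j)$ iff $x\le y$ and $i\le j$. A linear extension of a poset is a total order $\prec$ (with reverse $\succ$) such that $u\le v$ with $u\ne v$ implies $u\prec v$. For $0\le i\le j<n$, $a_{i,j}:=(\phi(j-i),j)\in\mathcal C_j$. For every cover $b\lessdot c$ of $\mathrm{Tam}(P,\phi)$ the set $c\setminus b$ has a maximum element for the order $\le$ of $\mathcal C_P^\phi$; the edge-labelling $\omega_{\mathcal L}$ is defined by $\omega_{\mathcal L}(b\lessdot c):=i$, where $\max(c\setminus b)=x_i$ (labels are integers with their usual order). An element $a$ of a lattice is left modular if $(b\vee a)\wedge c=b\vee(a\wedge c)$ for all $b<c$; a lattice is left modular if it has a maximal chain all of whose elements are left modular. An $EL$-labelling of a lattice is a labelling of its cover relations such that in any interval, reading labels along maximal chains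 from bottom to top, there is a unique (strictly) increasing maximal chain, and its label word lexicographically precedes the label word of every other maximal chain of the interval. A decreasing maximal chain is one whose labels, read from bottom to top, are decreasing. *)

(* Defs.v *)
From HB Require Import structures.
From mathcomp Require Import all_boot all_order all_algebra.

Set Implicit Arguments.
Unset Strict Implicit.
Unset Printing Implicit Defensive.

Import Order.Theory GRing.Theory.

Local Open Scope order_scope.

Section FinPOrder.
Context {d : Order.disp_t} {L : finPOrderType d}.
Implicit Types (x y z : L) (s t : seq L) (lab : L -> L -> nat).

Definition covers x y : bool := (x < y) && [forall z, ~~ (x < z < y)].

(* A chain is the increasing sequence of its elements; it is maximal in [x, y]
   if no further element of [x, y] is comparable with all of its elements. *)
Definition maximal_chain x y s : bool :=
  [&& sorted <%O s, all (fun z => x <= z <= y) s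
    & [forall z, (x <= z <= y) && all (fun w => z >=< w) s ==> (z \in s)]].

Definition label_word lab s : seq nat :=
  if s is x :: s' then pairmap lab x s' else [::].

Definition increasing_chain lab s : bool := sorted ltn (label_word lab s).

(* Weakly decreasing, as required for computing Moebius values from an
   EL-labelling whose increasing chains are strictly increasing. *)
Definition decreasing_chain lab s : bool := sorted geq (label_word lab s).

(* [lab] is only ever evaluated on consecutive elements of maximal chains,
   i.e. on cover relations. *)
Definition EL_labelling lab : Prop :=
  forall x y, x <= y ->
  exists s,
    [/\ maximal_chain x y s,
        increasing_chain lab s,
        (forall t, maximal_chain x y t -> increasing_chain lab t -> t = s)
      & (forall t, maximal_chain x y t -> t <> s ->
           (label_word lab s : seqlexi nat) < (label_word lab t : seqlexi nat))].

Fixpoint mobius_rec (k : nat) x y : int :=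
  if k is k'.+1 then
    if x == y then 1%R
    else if x < y then (- \sum_(z | (x <= z < y)%O) mobius_rec k' x z)%R
    else 0%R
  else 0%R.

(* The fuel #|L| suffices: see [mobiusxx] and [mobius_lt] below. *)
Definition mobius x y : int := mobius_rec #|L| x y.

Lemma maximal_chainP x y s : x <= y ->
  reflect (exists2 s', s = x :: s' & path covers x s' && (last x s' == y))
          (maximal_chain x y s).
Proof.
move=> le_xy; apply: (iffP idP) => [/and3P[s_sorted /allP s_in /forallP s_max]|].
  have xs : x \in s.
    apply: (implyP (s_max x)); rewrite lexx le_xy /=.
    by apply/allP => w /s_in /andP[xw _]; rewrite /Order.comparable xw.
  have ys : y \in s.
    apply: (implyP (s_max y)); rewrite lexx le_xy /=.
    by apply/allP => w /s_in /andP[_ wy]; rewrite /Order.comparable wy orbT.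
  case: s => [//|a s] in s_sorted s_in s_max xs ys *.
  have [ax _] := andP (s_in a (mem_head _ _)).
  have eax : a = x.
    move: xs; rewrite inE => /predU1P[-> //|xs]; apply/eqP.
    have /allP/(_ x xs) := order_path_min lt_trans s_sorted.
    by move=> /(le_lt_trans ax); rewrite ltxx.
  subst a; exists s => //.
  have le_mono := sorted_leq_nth le_trans lexx x
      (sub_path (fun _ _ => @ltW _ _ _ _) s_sorted : sorted <=%O (x :: s)).
  apply/andP; split; last first.
    rewrite eq_le; have /andP[_ ->] /= := s_in _ (mem_last x s).
    have /(nthP x)[k lt_k <-] := ys.
    by rewrite (last_nth x); apply: le_mono; rewrite ?inE //= -ltnS.
  apply/(pathP x) => i lt_i; set u := nth _ _ _.
  have ev : nth x s i = nth x (x :: s) i.+1 by [].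
  set v := nth x s i in ev *.
  have uv : u < v by apply: (pathP x s_sorted).
  rewrite /covers uv /=; apply/forallP => z; apply/negP => /andP[uz zv].
  have i1 : (i < size (x :: s))%N by rewrite ltnS ltnW.
  have i2 : (i.+1 < size (x :: s))%N by rewrite ltnS.
  have us : u \in x :: s by rewrite mem_nth.
  have vs : v \in x :: s by rewrite ev mem_nth.
  have zs : z \in x :: s.
    apply: (implyP (s_max z)); apply/andP; split.
      have /andP[xu _] := s_in _ us; have /andP[_ vy] := s_in _ vs.
      by rewrite (le_trans xu (ltW uz)) (le_trans (ltW zv) vy).
    apply/(all_nthP x) => j lt_j; rewrite /Order.comparable.
    case: (leqP j i) => ji; apply/orP; [right|left].
      by apply: le_trans (ltW uz); apply: le_mono.
    by apply: le_trans (ltW zv) _; rewrite ev; apply: le_mono.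
  move: zs => /(nthP x)[j lt_j ez].
  case: (leqP j i) => ji.
    have := le_mono j i lt_j i1 ji; rewrite ez => /(lt_le_trans uz).
    by rewrite ltxx.
  have := le_mono i.+1 j i2 lt_j ji.
  by rewrite ez -ev => /(lt_le_trans zv); rewrite ltxx.
case=> s' -> /andP[]; elim: s' => [|a s' IH] in x le_xy *.
  move=> _ /eqP/= <-; rewrite /maximal_chain /= lexx /=.
  apply/forallP => z; apply/implyP => /andP[zx _].
  by rewrite inE eq_le andbC.
rewrite /= => /andP[/andP[xa /forallP xaP] pth] lst.
have ay : a <= y.
  rewrite -(eqP lst); elim: (s') (a) pth => [|b r IHr] c //=.
  by case/andP=> /andP[cb _] /IHr; apply: le_trans (ltW cb).
have /and3P[srt /allP inn /forallP mx] := IH a ay pth lst.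
apply/and3P; split; first by rewrite /= xa.
  apply/allP => z; rewrite inE => /predU1P[->|/inn /andP[az ->]].
    by rewrite lexx.
  by rewrite (le_trans (ltW xa) az).
apply/forallP => z; apply/implyP => /andP[/andP[xz zy]] /and3P[_ ca cmp].
rewrite inE; case: eqVneq => //= nzx.
apply: (implyP (mx z)); rewrite zy andbT; apply/andP; split; last exact/andP.
case/orP: ca => // za; case: (eqVneq z a) => [->|nza]; first exact: lexx.
by have := xaP z; rewrite !lt_neqAle eq_sym nzx xz nza za.
Qed.

Lemma mobius_recE k x y : (#|[set z | (z <= y)%O]| <= k)%N ->
  mobius_rec k x y = mobius x y.
Proof.
rewrite /mobius.
suff H k1 k2 y0 : (#|[set z | (z <= y0)%O]| <= k1)%N ->
    (#|[set z | (z <= y0)%O]| <= k2)%N -> mobius_rec k1 x y0 = mobius_rec k2 x y0.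
  by move=> Hk; apply: H => //; apply: max_card.
elim: k1 => [|k1 IH] in k2 y0 *.
  by rewrite leqn0 cards_eq0 => /eqP/setP/(_ y0); rewrite !inE lexx.
case: k2 => [|k2].
  by move=> _; rewrite leqn0 cards_eq0 => /eqP/setP/(_ y0); rewrite !inE lexx.
move=> H1 H2 /=; case: eqP => // _; case: ifP => // _; congr (- _)%R.
apply: eq_bigr => z /andP[_ zy].
have lt_card : (#|[set w | (w <= z)%O]| < #|[set w | (w <= y0)%O]|)%N.
  apply: proper_card; apply/properP; split.
    by apply/subsetP => w; rewrite !inE => /le_trans; apply; apply: ltW.
  by exists y0; rewrite !inE ?lexx // (lt_geF zy).
by apply: IH; rewrite -ltnS; apply: leq_trans lt_card _.
Qed.

Lemma mobiusxx x : mobius x x = 1%R.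
Proof.
rewrite -(@mobius_recE #|L|.+1) /= ?eqxx //.
by apply: leq_trans (leqnSn _); apply: max_card.
Qed.

Lemma mobius_lt x y : x < y ->
  mobius x y = (- \sum_(z | (x <= z < y)%O) mobius x z)%R.
Proof.
move=> xy; rewrite -(@mobius_recE #|L|.+1) /=; last first.
  by apply: leq_trans (leqnSn _); apply: max_card.
by rewrite (lt_eqF xy) xy.
Qed.

End FinPOrder.

Section LeftModular.
Context {d : Order.disp_t}.

Definition left_modular {L : latticeType d} (a : L) : Prop :=
  forall b c : L, b < c -> (b `|` a) `&` c = b `|` (a `&` c).

Definition left_modular_lattice (L : finTBLatticeType d) : Prop :=
  exists s : seq L,
    maximal_chain \bot \top s /\ (forall a, a \in s -> left_modular a).

End LeftModular.

(* A strict total order [prec] on [D] extending the partial order [le]. *)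
Definition linear_extension (T : finType) (D : {set T}) (le prec : rel T) :=
  [/\ {in D, forall u, ~~ prec u u},
      {in D & &, forall v u w, prec u v -> prec v w -> prec u w},
      {in D &, forall u v, u <> v -> prec u v \/ prec v u}
    & {in D &, forall u v, le u v -> u <> v -> prec u v}].

(* [xs] lists the elements of [D] in decreasing order for [prec]. *)
Definition decreasing_enum (T : finType) (D : {set T}) (prec : rel T)
    (xs : seq T) : Prop :=
  xs =i D /\ sorted (fun u v => prec v u) xs.

(* Only the values phi 0, ..., phi (n - 1) matter. *)
Record bot_chain d (P : finBPOrderType d) (n : nat) := BotChain {
  bot_chain_fun :> nat -> P;
  bot_chain_gt0 : (0 < n)%N;
  bot_chain0 : bot_chain_fun 0 = \bot;
  bot_chain_lt : forall i j, (i < j < n)%N -> bot_chain_fun i < bot_chain_fun j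
}.

Section Tam.
Context {d : Order.disp_t} {P : finBPOrderType d} {n : nat}.
Variable phi : bot_chain P n.
Implicit Types (u v w : P * 'I_n) (F G : {set P * 'I_n}).

Definition carrier : {set P * 'I_n} := [set u : P * 'I_n | u.1 <= phi u.2].

Definition le_sum u v : bool := (u.2 == v.2) && (u.1 <= v.1).

Definition le_prod u v : bool := (u.1 <= v.1) && (u.2 <= v.2)%N.

(* The element a_{i,j}, meant for i <= j. *)
Definition chain_elt (i : nat) (j : 'I_n) : P * 'I_n := (phi (j - i)%N, j).

Definition order_filter F : bool :=
  (F \subset carrier) &&
  [forall u in F, forall v in carrier, le_sum u v ==> (v \in F)].

Definition torclosed F : bool :=
  [forall x : P, forall i : 'I_n, forall j : 'I_n,
     [&& (i < j)%N, (x, i) \in F & (phi i.+1, j) \in F] ==> ((x, j) \in F)].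

Definition in_Tam F : bool := order_filter F && torclosed F.

Definition Tam : Type := {F : {set P * 'I_n} | in_Tam F}.

Lemma order_filterP F :
  reflect ((forall u, u \in F -> u.1 <= phi u.2) /\
           (forall x y i, (x, i) \in F -> x <= y -> y <= phi i -> (y, i) \in F))
          (order_filter F).
Proof.
apply: (iffP andP) => [[/subsetP sF /forall_inP H]|[sF H]].
  split=> [u /sF|x y i Fx xy yi]; first by rewrite inE.
  have /forall_inP Hx := H _ Fx.
  by apply: (implyP (Hx (y, i) _)); rewrite ?inE // /le_sum /= eqxx.
split; first by apply/subsetP => u /sF; rewrite inE.
apply/forall_inP => -[x i] Fx; apply/forall_inP => -[y j].
rewrite inE /= => yj; apply/implyP => /andP[/= /eqP eij xy].
by subst j; apply: H xy yj.
Qed.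

Lemma torclosedP F :
  reflect (forall x (i j : 'I_n), (i < j)%N -> (x, i) \in F ->
             (phi i.+1, j) \in F -> (x, j) \in F)
          (torclosed F).
Proof.
apply: (iffP idP) => [H x i j ij Fx Fj|H].
  by move: H => /forallP/(_ x)/forallP/(_ i)/forallP/(_ j); rewrite ij Fx Fj.
do 3![apply/forallP => ?]; apply/implyP => /and3P[]; exact: H.
Qed.

Lemma bot_chain_le i j : (i <= j < n)%N -> phi i <= phi j.
Proof.
case/andP; rewrite leq_eqVlt => /predU1P[->//|ij jn].
by apply: ltW; apply: bot_chain_lt; rewrite ij.
Qed.

Fact tam0 : in_Tam set0.
Proof.
apply/andP; split; last by apply/torclosedP => x i j _; rewrite inE.
by apply/order_filterP; split=> [u|x y i]; rewrite inE.
Qed.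

Fact tam_bigcap (I : finType) (A : pred I) (F : I -> {set P * 'I_n}) :
  (forall i, A i -> in_Tam (F i)) ->
  in_Tam (carrier :&: \bigcap_(i | A i) F i).
Proof.
move=> HF; apply/andP; split.
  apply/order_filterP; split=> [u|x y i]; first by rewrite !inE => /andP[].
  rewrite !in_setI => /andP[_ /bigcapP Fx] xy yi; rewrite inE yi /=.
  apply/bigcapP => k Ak; have /andP[/order_filterP[_ fk] _] := HF k Ak.
  by apply: fk xy yi; apply: Fx.
apply/torclosedP => x i j ij; rewrite !in_setI.
move=> /andP[Cx /bigcapP Fx] /andP[_ /bigcapP Fj]; apply/andP; split.
  move: Cx; rewrite !inE /= => /le_trans; apply.
  by apply: bot_chain_le; rewrite ltn_ord ltnW.
apply/bigcapP => k Ak; have /andP[_ /torclosedP tk] := HF k Ak.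
by apply: tk ij _ _; [apply: Fx | apply: Fj].
Qed.

HB.instance Definition _ := SubFinite.on Tam.

Implicit Types a b c : Tam.

Definition tam_le b c : bool := val b \subset val c.

Fact tam_le_refl : reflexive tam_le.
Proof. by move=> b; apply: subxx. Qed.

Fact tam_le_anti : antisymmetric tam_le.
Proof. by move=> b c H; apply/val_inj/eqP; rewrite eqEsubset. Qed.

Fact tam_le_trans : transitive tam_le.
Proof. by move=> c b a; apply: subset_trans. Qed.

HB.instance Definition _ := Order.Le_isPOrder.Build (Order.Disp tt tt) Tam
  tam_le_refl tam_le_anti tam_le_trans.

Lemma tam_leE b c : (b <= c) = (val b \subset val c).
Proof. by []. Qed.

Fact tam_sub_carrier b : val b \subset carrier.
Proof. by have /andP[/andP[]] := valP b. Qed.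

Fact tam_meet_subproof b c : in_Tam (val b :&: val c).
Proof.
have -> : val b :&: val c =
    carrier :&: \bigcap_(i : bool) (if i then val b else val c).
  rewrite big_bool /= setIA; congr (_ :&: _); apply/esym/setIidPr.
  exact: tam_sub_carrier.
by apply: tam_bigcap => -[] _; [exact: (valP b) | exact: (valP c)].
Qed.

Definition tam_meet b c : Tam := exist in_Tam _ (tam_meet_subproof b c).

Definition tam_join b c : Tam :=
  exist in_Tam _ (@tam_bigcap Tam (fun a => (b <= a) && (c <= a)) val
                     (fun a _ => valP a)).

Definition tam_bot : Tam := exist in_Tam set0 tam0.

Definition tam_top : Tam :=
  exist in_Tam _ (@tam_bigcap void predT (fun=> set0) (fun i => match i with end)).

Fact tam_meetP a b c : (a <= tam_meet b c) = (a <= b) && (a <= c).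
Proof. by rewrite !tam_leE /= subsetI. Qed.

Fact tam_joinP b c a : (tam_join b c <= a) = (b <= a) && (c <= a).
Proof.
have ub e : (b <= e) && (c <= e) -> tam_join b c <= e.
  by move=> He; rewrite tam_leE /=; apply: subset_trans (subsetIr _ _) (bigcap_inf e He).
apply/idP/idP => [|/ub//].
suff /andP[bj cj] : (b <= tam_join b c) && (c <= tam_join b c).
  by move=> ja; rewrite (le_trans bj ja) (le_trans cj ja).
rewrite !tam_leE /= !subsetI !tam_sub_carrier /=.
by apply/andP; split; apply/bigcapsP => e /andP[].
Qed.

HB.instance Definition _ := Order.POrder_MeetJoin_isLattice.Build _ Tam
  tam_meetP tam_joinP.

Fact tam_bot_le b : tam_bot <= b.
Proof. by rewrite tam_leE /= sub0set. Qed.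

Fact tam_le_top b : b <= tam_top.
Proof.
by rewrite tam_leE /= big_pred0 ?setIT ?tam_sub_carrier //; case.
Qed.

HB.instance Definition _ := Order.hasBottom.Build _ Tam tam_bot_le.
HB.instance Definition _ := Order.hasTop.Build _ Tam tam_le_top.

(* The default value 0 is never reached on covers: see [covers_diff_max]. *)
Definition omega (xs : seq (P * 'I_n)) b c : nat :=
  if [pick m in val c :\: val b | [forall u in val c :\: val b, le_sum u m]]
    is Some m then (index m xs).+1 else 0.

Lemma tam_meetE b c : val (b `&` c) = val b :&: val c.
Proof. by []. Qed.

Lemma tam_topE : val (\top : Tam) = carrier.
Proof. by rewrite SubK big_pred0 ?setIT //; case. Qed.

Lemma tam_botE : val (\bot : Tam) = set0.
Proof. by []. Qed.

Lemma covers_diff_max b c : covers b c ->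
  exists2 m, m \in val c :\: val b
           & forall u, u \in val c :\: val b -> le_sum u m.
Proof.
case/andP; rewrite lt_neqAle tam_leE => /andP[nbc bc] /forallP cov.
have cmax (a : Tam) : val b \subset val a -> val a \subset val c ->
    val b != val a -> val a = val c.
  move=> ba ac; rewrite (inj_eq val_inj) => nba; congr val; apply/eqP.
  apply: contraTT (cov a) => nac.
  by rewrite negbK !lt_neqAle nba nac !tam_leE ba ac.
have [/order_filterP[bC bF] /torclosedP bT] := andP (valP b).
have [/order_filterP[cC cF] /torclosedP cT] := andP (valP c).
have /set0Pn[u0 u0D] : val c :\: val b != set0.
  rewrite setD_eq0; apply: contra nbc => cb.
  by apply/eqP/val_inj/eqP; rewrite eqEsubset bc.
(* The new elements all lie in the highest level containing one of them. *)
have [u1 u1D u1max] :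
    exists2 w, w \in val c :\: val b
             & forall v, v \in val c :\: val b -> (v.2 <= w.2)%N.
  by case: (@arg_maxnP _ u0 (mem (val c :\: val b)) (fun w => w.2 : nat) u0D)
    => w wD wmax; exists w.
pose j := u1.2.
have lvl v : v \in val c -> (j < v.2)%N -> v \in val b.
  move=> vc jv; apply: contraTT jv => vb; rewrite -leqNgt.
  by apply: u1max; rewrite inE vb.
have lvlj v : v \in val c :\: val b -> v.2 = j.
  pose A := [set w in val c | (w \in val b) || (j <= w.2)%N].
  have AT : in_Tam A.
    apply/andP; split.
      apply/order_filterP; split=> [w|x y i]; first by rewrite inE => /andP[/cC].
      rewrite !inE /= => /andP[xc H] xy yi; rewrite (cF x y i) //=.
      by case/orP: H => [xb|->]; rewrite ?orbT // (bF x y i).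
    apply/torclosedP => x i k ik; rewrite !inE /=.
    move=> /andP[xc xb] /andP[kc kb]; rewrite (cT x i k) //=.
    case: (leqP j k) xb kb => [|kj]; first by move=> *; rewrite orbT.
    by rewrite leqNgt (ltn_trans ik kj) !orbF => xb kb; apply: bT ik xb kb.
  have Ac : A = val c.
    apply: (cmax (exist in_Tam A AT)).
    - by apply/subsetP => w wb; rewrite /= inE wb (subsetP bc).
    - by apply/subsetP => w; rewrite /= inE => /andP[].
    apply/eqP => /= /setP/(_ u1); move: u1D; rewrite !inE => /andP[/negbTE -> ->].
    by rewrite leqnn orbT.
  move=> vD; apply/val_inj/eqP; rewrite eqn_leq u1max //=.
  by move: vD; rewrite -Ac !inE => /andP[/negbTE-> /andP[]].
(* Adjoining a maximal new element not on the chain gives [c] at once. *)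
have ins x : (x, j) \in val c :\: val b ->
    (forall y, (y, j) \in val c :\: val b -> x <= y -> y = x) ->
    (forall i, (i < j)%N -> x != phi i.+1) -> val c :\: val b = [set (x, j)].
  move=> xD xmax xphi; have := xD; rewrite inE => /andP[xb xc].
  pose A := (x, j) |: val b.
  have AT : in_Tam A.
    apply/andP; split.
      apply/order_filterP; split=> [w|z y i].
        by rewrite !inE => /predU1P[->|/bC//]; apply: (cC _ xc).
      rewrite !inE => /predU1P[[-> ->]|zb] zy yi; last by rewrite (bF z y i) ?orbT.
      case: (boolP ((y, j) \in val b)) => yb; first by rewrite orbT.
      by rewrite (xmax y) ?eqxx // inE yb (cF x).
    apply/torclosedP => z i k ik; rewrite !inE.
    move=> /predU1P[[-> ei]|zb] /predU1P[[ek1 ek2]|kb].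
    - by move: ik; rewrite ek2 ei ltnn.
    - rewrite [_ \in val b]lvl ?orbT //=; last by rewrite -ei.
      by apply: (cT x i k ik); rewrite ?ei // -ei (subsetP bc).
    - by move: ik; rewrite ek2 => /xphi; rewrite -ek1 eqxx.
    by rewrite (bT z i k) ?orbT.
  have <- : A = val c.
    apply: (cmax (exist in_Tam A AT)) => /=.
    - exact: subsetU1.
    - by rewrite subUset sub1set xc bc.
    by apply/eqP => /setP/(_ (x, j)); rewrite !inE eqxx (negbTE xb).
  by rewrite setDUl setDv setU0; apply/setDidPl; rewrite disjoints1.
have above x : (x, j) \in val c :\: val b -> exists y,
    [/\ (y, j) \in val c :\: val b, x <= y
      & forall z, (z, j) \in val c :\: val b -> y <= z -> z = y].
  move=> xD; pose Q := [set y | ((y, j) \in val c :\: val b) && (x <= y)].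
  have xQ : x \in Q by rewrite inE xD lexx.
  case: (@arg_minnP _ x (mem Q) (fun y => #|[set z | (y < z)%O]|) xQ) => y.
  rewrite /= inE => /andP[yD xy] ymin; exists y; split=> // z zD yz.
  apply/eqP; apply: contraTT isT => nzy.
  have zQ : z \in Q by rewrite inE zD (le_trans xy yz).
  have lt_yz : y < z by rewrite lt_neqAle eq_sym nzy.
  have := ymin z zQ; rewrite leqNgt; suff -> : (#|[set w | (z < w)%O]| <
     #|[set w | (y < w)%O]|)%N by [].
  apply: proper_card; apply/properP; split.
    by apply/subsetP => w; rewrite !inE; apply: le_lt_trans.
  by exists z; rewrite !inE ?ltxx.
have eqj v : v \in val c :\: val b -> v = (v.1, j).
  by move=> /lvlj <-; case: v.
have [y0 [y0D _ y0max]] : exists y,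
    [/\ (y, j) \in val c :\: val b, u1.1 <= y
      & forall z, (z, j) \in val c :\: val b -> y <= z -> z = y].
  by apply: above; rewrite -eqj.
have offchain y : (y, j) \in val c :\: val b ->
    (forall z, (z, j) \in val c :\: val b -> y <= z -> z = y) ->
    (forall i, (i < j)%N -> y != phi i.+1) ->
    exists2 m, m \in val c :\: val b
           & forall u, u \in val c :\: val b -> le_sum u m.
  move=> yD ymax yphi; exists (y, j) => // v; rewrite (ins y) // inE => /eqP->.
  by rewrite /le_sum eqxx lexx.
have onchain y : (forall i, (i < j)%N -> y != phi i.+1) \/
    exists2 i, (i < j)%N & y = phi i.+1.
  case: (boolP [exists i : 'I_j, y == phi i.+1]) => [/existsP[i /eqP ->]|].
    by right; exists i.
  rewrite negb_exists => /forallP H; left => i ij; exact: (H (Ordinal ij)).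
have [|[i0 i0j e0]] := onchain y0; first exact: offchain.
case: (boolP [forall u in val c :\: val b, le_sum u (y0, j)]) => [|].
  by move=> /forall_inP H; exists (y0, j).
rewrite negb_forall_in => /exists_inP[v vD nle].
have vD' := vD; rewrite (eqj v vD) in vD'.
have [y1 [y1D vy1 y1max]] := above _ vD'.
have [|[i1 i1j e1]] := onchain y1; first exact: offchain.
case/negP: nle; rewrite /le_sum /= (lvlj v vD) eqxx /=.
have jn := ltn_ord j.
case: (leqP i0 i1) => le_i.
  rewrite -(y0max y1) // e0 e1; apply: bot_chain_le.
  by rewrite ltnS le_i /=; apply: leq_ltn_trans jn.
rewrite (y1max y0) // e0 e1; apply: bot_chain_le.
by rewrite ltnS ltnW //=; apply: leq_ltn_trans jn.
Qed.

End Tam.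

(* Main.v *)
(* The left modular chain consists of the segments X_m = {x_1, ..., x_m}: the
   explicit description of [b `|` X_m] (see [forced]) yields cancellation, i.e.
   b <= c with equal meets and joins with X_m forces b = c.

   On a cover b < c the label is the first index of an element of c \ b; this
   "first difference" makes sense for every b <= c.  It is the minimum of the
   first differences on the two parts of a split interval, and by cancellation
   exactly one atom of [b, c] attains it.  These two properties alone give the
   EL-property, and they collapse the signed count of decreasing chains to the
   recursion that defines the Moebius function.

   A decreasing chain from b to c is unique because its labels must be the
   indices of the maximal elements of c \ b, and a label word determines the
   chain.  Finally, sorting by level and then by the number of chain elements
   not above gives an ordering that satisfies (i) and (ii), as needed for the
   statements that do not mention one. *)

Require Import Defs.
From HB Require Import structures.
From mathcomp Require Import all_boot all_order all_algebra.

Set Implicit Arguments.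
Unset Strict Implicit.
Unset Printing Implicit Defensive.

Import Order.Theory GRing.Theory.

Local Open Scope order_scope.

(** * Labellings determined by first differences in a finite poset *)

Section FirstLabel.
Context {d : Order.disp_t} {L : finPOrderType d}.
Implicit Types (x y z : L) (s t : seq L) (lab lam : L -> L -> nat).

Lemma lt_up_card x y : x < y ->
  (#|[set z | (y <= z)%O]| < #|[set z | (x <= z)%O]|)%N.
Proof.
move=> xy; apply: proper_card; apply/properP; split.
  by apply/subsetP => z; rewrite !inE; apply/le_trans/ltW.
by exists x; rewrite !inE ?lexx // (lt_geF xy).
Qed.

Lemma gt_ind (Q : L -> Prop) :
  (forall x, (forall y, x < y -> Q y) -> Q x) -> forall x, Q x.
Proof.
move=> H x; have [k] := ubnP #|[set z | (x <= z)%O]|.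
elim: k x => // k IH x xk; apply: H => y xy; apply: IH.
exact: leq_trans (lt_up_card xy) xk.
Qed.

Lemma path_covers_le x s : path covers x s -> x <= last x s.
Proof.
elim: s x => //= a s IH x /andP[/andP[xa _] /IH]; exact/le_trans/ltW.
Qed.

Lemma covers_eq x y z : covers x z -> x < y -> y <= z -> y = z.
Proof.
move=> /andP[_ /forallP/(_ y)] cov xy; rewrite le_eqVlt => /predU1P[//|yz].
by rewrite xy yz in cov.
Qed.

(* [lam x y] plays the role of the smallest label occurring on the maximal
   chains of [x, y], and [lam y y] that of infinity: on a cover, the third
   clause says [lam x y < lam y y]. *)
Definition first_label lab lam : Prop :=
  [/\ forall x y, covers x y -> lab x y = lam x y,
      forall x y z, x <= y -> y <= z -> lam x z = minn (lam x y) (lam y z)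
    & forall x z, x < z -> exists y,
        [/\ covers x y, y <= z, (lam x z < lam y z)%N
          & forall a, covers x a -> a <= z -> a <> y -> (lam x z < lam x a)%N]].

Section Theory.
Context {lab lam : L -> L -> nat} (lamP : first_label lab lam).

Let lab_lam x y : covers x y -> lab x y = lam x y.
Proof. by case: lamP => /(_ x y). Qed.

Let lam_min x y z : x <= y -> y <= z -> lam x z = minn (lam x y) (lam y z).
Proof. by case: lamP => _ /(_ x y z). Qed.

Let lam_atom x z : x < z -> exists y,
  [/\ covers x y, y <= z, (lam x z < lam y z)%N
    & forall a, covers x a -> a <= z -> a <> y -> (lam x z < lam x a)%N].
Proof. by case: lamP => _ _ /(_ x z). Qed.

Let lam_atomE x y z : x <= y -> y <= z -> (lam x z < lam y z)%N ->
  lam x y = lam x z.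
Proof. move=> xy yz; rewrite (lam_min xy yz) gtn_min ltnn orbF.
by move=> /ltnW/minn_idPl.
Qed.

(** With the uniqueness in [lam_atom], this singles out the atom that begins an increasing chain. *)
Lemma lab_lt_lam x a z : covers x a -> a <= z -> (lab x a < lam a z)%N ->
  lam x a = lam x z.
Proof.
move=> xa az; have /andP[/ltW lexa _] := xa.
by rewrite lab_lam // (lam_min lexa az) => /ltnW/minn_idPl.
Qed.

(** The only atom of [[x, a]] is [a], so [lam_atom] compares its label with the infinite value
    [lam a a]. *)
Lemma lab_lt_lamxx x a : covers x a -> (lab x a < lam a a)%N.
Proof.
move=> xa; have /andP[ltxa _] := xa; have [y [xy ya + _]] := lam_atom ltxa.
by rewrite (covers_eq xa _ ya) ?lab_lam //; case/andP: xy.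
Qed.

Lemma lam_in x s : path covers x s -> x < last x s ->
  lam x (last x s) \in pairmap lab x s.
Proof.
elim: s x => [|a s IH] x /=; first by rewrite ltxx.
move=> /andP[xa pth] _; have /andP[ltxa _] := xa.
have le_a := path_covers_le pth.
rewrite (lam_min (ltW ltxa) le_a) -lab_lam // inE.
case: (leqP (lab x a) (lam a (last a s))) => h; first by rewrite eqxx.
move: le_a; rewrite le_eqVlt => /predU1P[eqa|lt_a]; last by rewrite IH ?orbT.
by have := lab_lt_lamxx xa; rewrite {3}eqa ltnNge (ltnW h).
Qed.

Lemma lam_le_labels x s : path covers x s ->
  all (leq (lam x (last x s))) (pairmap lab x s).
Proof.
elim: s x => //= a s IH x /andP[xa pth]; have /andP[ltxa _] := xa.
rewrite (lam_min (ltW ltxa) (path_covers_le pth)) -lab_lam // geq_minl /=.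
by apply: sub_all (IH a pth) => m; apply: leq_trans; apply: geq_minr.
Qed.

(** The minimum of the later labels is itself a label ([lam_in]), so it exceeds the first one; for
    an empty rest [lam a a] is infinite. *)
Lemma increasing_head x a s : path covers x (a :: s) ->
  sorted ltn (pairmap lab x (a :: s)) -> (lab x a < lam a (last a s))%N.
Proof.
move=> /= /andP[xa pth] /(order_path_min ltn_trans)/allP srt.
have := path_covers_le pth; rewrite le_eqVlt => /predU1P[eqa|lt_a].
  by have := lab_lt_lamxx xa; rewrite {3}eqa.
exact/srt/lam_in.
Qed.

(** Induction on [x] from the top. The increasing chain starts with the atom [a] attaining [lam x y]
    and goes on in [[a, y]], where all labels are larger. Any other atom [b] has a larger label,
    hence a later word, and begins no increasing chain: [increasing_head] would give
    [lam x b = lam x y]. *)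
Lemma first_label_EL : EL_labelling lab.
Proof.
suff H x y : x <= y -> exists s,
    [/\ path covers x s, last x s = y, sorted ltn (pairmap lab x s)
      & forall t, path covers x t -> last x t = y -> t <> s ->
          ~~ sorted ltn (pairmap lab x t) /\
          (pairmap lab x s : seqlexi nat) < (pairmap lab x t : seqlexi nat)].
  move=> x y xy; have [s [ps ls incs sU]] := H x y xy; exists (x :: s).
  split=> // [|t /(maximal_chainP _ xy)[t' -> /andP[pt /eqP lt]]|
               t /(maximal_chainP _ xy)[t' -> /andP[pt /eqP lt]] nts].
  - by apply/(maximal_chainP _ xy); exists s => //; rewrite ps ls eqxx.
  - move=> inct; case: (eqVneq t' s) => [-> //|/eqP nts].
    by have [/negP] := sU t' pt lt nts.
  - by have [|_] := sU t' pt lt => // e; apply: nts; rewrite e.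
elim/gt_ind: x => x IH; rewrite le_eqVlt => /predU1P[->|xy].
  exists [::]; split=> // -[|a t] //= /andP[/andP[ya _] pt] lt.
  by have := path_covers_le pt; rewrite lt => /(lt_le_trans ya); rewrite ltxx.
have [a [xa ay lt_a aU]] := lam_atom xy; have /andP[ltxa _] := xa.
have eqa := lam_atomE (ltW ltxa) ay lt_a.
have [s [ps ls incs sU]] := IH a ltxa ay.
exists (a :: s); split=> //=; first by rewrite xa.
  rewrite path_min_sorted // lab_lam // eqa.
  apply: sub_all (lam_le_labels ps) => m; rewrite ls; exact: leq_trans.
case=> [_ lt|b t /= /andP[xb pt] lt nt]; first by rewrite -lt ltxx in xy.
have by_ : b <= y by rewrite -lt path_covers_le.
case: (eqVneq b a) => [eba|/eqP nba].
  subst b; have [|incN lexi] := sU t pt lt.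
    by move=> e; apply: nt; rewrite e.
  rewrite ltxi_cons lexx lexi; split=> //.
  by apply: contra incN => /path_sorted.
have lt_ab := aU b xb by_ nba; split; last first.
  by rewrite ltxi_cons leEnat !lab_lam // eqa (ltnW lt_ab) leqNgt lt_ab.
apply/negP => inc; have ptb : path covers x (b :: t) by rewrite /= xb.
have := increasing_head ptb inc; rewrite lt => /(lab_lt_lam xb by_) eqb.
by rewrite eqb ltnn in lt_ab.
Qed.

(** * Moebius values as signed counts of decreasing chains *)

(* Signed count of the decreasing chains of [x, y] whose labels are at most
   [m], with fuel [k]. *)
Fixpoint dec_count (k m : nat) x y : int :=
  if k is k'.+1 then
    if x == y then 1%R
    else (- \sum_(a | covers x a && (a <= y)%O && (lab x a <= m)%N)
              dec_count k' (lab x a) a y)%R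
  else 0%R.

(* The sum telescopes: expanding along the first step, the inner sum is 1
   exactly for the atom that begins the increasing chain of [x, y]. *)
Lemma sum_dec_count k m x y : (#|[set z | (x <= z)%O]| <= k)%N -> x <= y ->
  (\sum_(z | (x <= z <= y)%O) dec_count k m x z)%R =
  ((x == y) || (m < lam x y)%N)%:R%R.
Proof.
elim: k m x => [|k IH] m x.
  by rewrite leqn0 cards_eq0 => /eqP/setP/(_ x); rewrite !inE lexx.
move=> xk; rewrite le_eqVlt => /predU1P[->|xy].
  rewrite eqxx (bigD1 y) /= ?lexx // eqxx big1 ?addr0 // => z.
  by move=> /andP[zy /negP[]]; rewrite eq_le andbC.
rewrite (lt_eqF xy) (bigD1 x) /= ?lexx ?(ltW xy) // eqxx.
(* The term [z = x] contributes 1; the others are regrouped by the first step [a] of the chains they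
   count. *)
have -> : (\sum_(z | (x <= z <= y)%O && (z != x))
    (if x == z then 1 else
     - \sum_(a | covers x a && (a <= z)%O && (lab x a <= m)%N)
         dec_count k (lab x a) a z) =
  - \sum_(a | covers x a && (a <= y)%O && (lab x a <= m)%N)
     \sum_(z | (a <= z <= y)%O) dec_count k (lab x a) a z)%R.
  rewrite -sumrN; under [RHS]eq_bigr do rewrite -sumrN.
  rewrite [RHS](exchange_big_dep (fun z => (x <= z <= y)%O && (z != x))) /=.
    apply: eq_bigr => z /andP[/andP[xz zy] zx]; rewrite eq_sym (negbTE zx).
    rewrite -sumrN; apply: eq_bigl => a; rewrite zy andbT.
    case: (covers x a) (lab x a <= m)%N => [] [] //=; rewrite ?andbF ?andbT //.
    by apply/idP/andP => [az|[]//]; rewrite az (le_trans az zy).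
  move=> a z /andP[/andP[/andP[xa _] ay] _] /andP[az ->].
  by rewrite (le_trans (ltW xa) az) gt_eqF // (lt_le_trans xa az).
have [a [xa ay lt_a aU]] := lam_atom xy; have /andP[ltxa _] := xa.
have eqa := lam_atomE (ltW ltxa) ay lt_a.
(* By induction the inner sum for [b] is 1 exactly if [b = y] or [lab x b < lam b y]; both force
   [b = a]. *)
rewrite (eq_bigr (fun b => (b == a)%:R%R)); last first.
  move=> b /andP[/andP[xb by_] _]; have /andP[ltxb _] := xb.
  rewrite IH //; last by rewrite -ltnS; apply: leq_trans (lt_up_card ltxb) xk.
  congr (nat_of_bool _)%:R%R; apply/idP/eqP => [/orP|->].
    case=> [/eqP eb|/(lab_lt_lam xb by_) eb]; apply/eqP.
      by apply/eqP; rewrite (covers_eq xb ltxa) ?eb.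
    apply: contraTT isT => /eqP nba; have := aU b xb by_ nba.
    by rewrite eb ltnn.
  by rewrite lab_lam // eqa lt_a orbT.
rewrite -lab_lam // in eqa; rewrite -eqa; case: ltnP => am.
  rewrite big1 ?oppr0 ?addr0 // => b /andP[_ bm]; case: eqVneq => // eba.
  by rewrite eba leqNgt am in bm.
rewrite (bigD1 a) ?xa ?ay //= eqxx big1 ?addr0 ?subrr // => b.
by case/andP=> _ /negbTE->.
Qed.

(** As no label exceeds [m], [sum_dec_count] gives 0 whenever [x < y], which is the Moebius
    recursion. The fuel depends on [x] alone, so all terms of the recursion share it. *)
Lemma mobius_dec_count m x y : (forall a b, covers a b -> lab a b <= m)%N ->
  x <= y -> mobius x y = dec_count #|[set z | (x <= z)%O]| m x y.
Proof.
move=> labm; set k := #|_|.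
have [j] := ubnP #|[set z | (z <= y)%O]|; elim: j y => // j IH y yj.
rewrite le_eqVlt => /predU1P[<-|xy].
  have k1 : (0 < k)%N by rewrite card_gt0; apply/set0Pn; exists x; rewrite inE.
  by rewrite mobiusxx -(prednK k1) /= eqxx.
rewrite mobius_lt //; apply/esym/eqP; rewrite -addr_eq0.
have := sum_dec_count m (leqnn k) (ltW xy).
rewrite (lt_eqF xy) ltnNge /=.
have -> : (lam x y <= m)%N.
  have [a [xa ay lt_a aU]] := lam_atom xy; have /andP[ltxa _] := xa.
  by rewrite -(lam_atomE (ltW ltxa) ay lt_a) -lab_lam // labm.
rewrite (bigD1 y) ?lexx ?(ltW xy) //= => S0; apply/eqP; rewrite -[RHS]S0.
congr (_ + _)%R; apply: eq_big => [z|z /andP[xz zy]].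
  by rewrite lt_neqAle -andbA [(z != y) && _]andbC.
apply: IH => //; rewrite -ltnS; apply: leq_trans yj.
rewrite ltnS; apply: proper_card; apply/properP; split.
  by apply/subsetP => w; rewrite !inE => /le_trans/(_ (ltW zy)).
by exists y; rewrite !inE ?lexx // (lt_geF zy).
Qed.

Hypothesis dec_uniq : forall x y s t, path covers x s -> path covers x t ->
  last x s = y -> last x t = y ->
  sorted geq (pairmap lab x s) -> sorted geq (pairmap lab x t) -> s = t.

Lemma dec_count_chain k m x y : dec_count k m x y != 0%R ->
  exists s, [/\ path covers x s, last x s = y & path geq m (pairmap lab x s)].
Proof.
elim: k m x => [|k IH] m x //=.
case: (eqVneq x y) => [->|nxy]; first by exists [::].
have [a Ha|H0] := pickP (fun a => (covers x a && (a <= y) && (lab x a <= m)%N)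
    && (dec_count k (lab x a) a y != 0%R)); last first.
  rewrite big1 ?oppr0 ?eqxx // => a Pa; apply/eqP.
  by have := H0 a; rewrite /= Pa => /negbT; rewrite negbK.
move: Ha => /andP[/andP[/andP[xa ay] am] /IH[s [ps ls decs]]] _.
by exists (a :: s); rewrite /= xa ps ls /= am.
Qed.

(** Two nonzero summands would yield two decreasing chains with different first steps; so at most
    one survives, and each unfolding just flips its sign. *)
Lemma dec_count_small k m x y :
  dec_count k m x y \in [:: (-1)%R; 0%R; 1%R].
Proof.
elim: k m x => [|k IH] m x; first by [].
rewrite [dec_count _ _ _ _]/=.
case: (eqVneq x y) => [_|nxy]; first by [].
have [a Ha|H0] := pickP (fun a => (covers x a && (a <= y) && (lab x a <= m)%N)
    && (dec_count k (lab x a) a y != 0%R)); last first.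
  rewrite big1 ?oppr0 ?inE ?eqxx ?orbT // => a Pa; apply/eqP.
  by have := H0 a; rewrite /= Pa => /negbT; rewrite negbK.
move: Ha => /andP[Pa /dec_count_chain[s [ps ls decs]]].
rewrite (bigD1 a) //= big1 ?addr0.
  have := IH (lab x a) a; rewrite !inE.
  by case/or3P=> /eqP->; rewrite ?opprK ?oppr0 ?eqxx ?orbT.
move=> b /andP[Pb nba]; apply/eqP; apply: contraNT nba.
move=> /dec_count_chain[t [pt lt dect]].
case/andP: Pa => /andP[xa _] _; case/andP: Pb => /andP[xb _] _.
suff [-> //] : b :: t = a :: s.
by apply: (@dec_uniq x y); rewrite //= ?xa ?xb.
Qed.

Lemma mobius_small x y : x <= y -> mobius x y \in [:: (-1)%R; 0%R; 1%R].
Proof.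
move=> xy; pose m := \max_(p : L * L) lab p.1 p.2.
rewrite (@mobius_dec_count m) ?dec_count_small // => a b _.
exact: (@leq_bigmax _ (fun p : L * L => lab p.1 p.2) (a, b)).
Qed.

End Theory.
End FirstLabel.

(** The two sides of the modular identity are comparable in every lattice and have the same meet and
    the same join with [a]. *)
Lemma left_modular_cancel d (L : latticeType d) (a : L) :
  (forall b c, b <= c -> c `&` a <= b -> c <= b `|` a -> c = b) ->
  left_modular a.
Proof.
move=> cancel b c /ltW bc; apply: cancel.
- by rewrite leUx !lexI leUl bc leIr leIxl ?leUr.
- by apply: lexUr; rewrite lexI leIr leIxl ?leIr.
- by apply: leIxl; rewrite leU2 ?leUl.
Qed.

(** * Orderings of the carrier, expressed by positions *)

Section Segments.
Context {d : Order.disp_t} {P : finBPOrderType d} {n : nat}.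
Context {phi : bot_chain P n}.
Implicit Types (u v w : P * 'I_n) (a b c : Tam phi) (xs : seq (P * 'I_n)).

(** A smaller index means a larger element of the ordering. The last clause is condition (ii), with
    [phi i] for the chain element [a_{k-i,k}]. *)
Definition admissible xs : Prop :=
  [/\ xs =i carrier phi, uniq xs,
      forall x y k, (y, k) \in carrier phi -> x <= y ->
        (index (y, k) xs <= index (x, k) xs)%N,
      forall u v, u \in carrier phi -> v \in carrier phi ->
        (u.2 < v.2)%N -> (index v xs < index u xs)%N
    & forall (k : 'I_n) x i, (i <= k)%N -> (x, k) \in carrier phi ->
        ~~ (x <= phi i) -> (index (x, k) xs < index (phi i, k) xs)%N].

Lemma carrier_chain (i : nat) (k : 'I_n) :
  (i <= k)%N -> (phi i, k) \in carrier phi.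
Proof. by move=> ik; rewrite inE /= bot_chain_le // ik ltn_ord. Qed.

Lemma tam_filter a x y k :
  (x, k) \in val a -> x <= y -> y <= phi k -> (y, k) \in val a.
Proof. by have /andP[/order_filterP[_ aF] _] := valP a; apply: aF. Qed.

Lemma tam_torclosed a x (i j : 'I_n) : (i < j)%N -> (x, i) \in val a ->
  (phi i.+1, j) \in val a -> (x, j) \in val a.
Proof. by have /andP[_ /torclosedP] := valP a; apply. Qed.

Lemma tam_carrier a u : u \in val a -> u.1 <= phi u.2.
Proof. by have /andP[/order_filterP[aC _] _] := valP a; apply: aC. Qed.

(** [find] returns the length of [xs] if nothing is found, so an empty difference gets a value
    beyond all labels; the successor is there because labels start at 1. *)
Definition first_diff xs b c : nat := (find (mem (val c :\: val b)) xs).+1.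

Lemma first_diff_min xs a b c : a <= b -> b <= c ->
  first_diff xs a c = minn (first_diff xs a b) (first_diff xs b c).
Proof.
rewrite !tam_leE => /subsetP ab /subsetP bc; rewrite /first_diff minnSS.
congr _.+1; elim: xs => //= u s ->.
rewrite !inE; have := ab u; have := bc u.
case: (u \in val a) (u \in val b) (u \in val c) => [] [] [] //= ab' bc';
  rewrite ?minnSS ?minn0 ?min0n //;
  by first [have := ab' isT | have := bc' isT].
Qed.

Lemma diff_carrier b c u : u \in val c :\: val b -> u \in carrier phi.
Proof. by rewrite inE => /andP[_]; apply/subsetP/tam_sub_carrier. Qed.

Lemma le_sum_filter a u v :
  u \in val a -> le_sum u v -> v \in carrier phi -> v \in val a.
Proof.
case: u v => [x i] [y j] ux /andP[/= /eqP eij xy]; rewrite inE; subst j.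
exact: tam_filter xy.
Qed.

Lemma le_sum_anti u v : le_sum u v -> le_sum v u -> u = v.
Proof.
case: u v => [x i] [y j] /andP[/= /eqP-> xy] /andP[_ /= yx].
by congr (_, _); apply/le_anti; rewrite xy.
Qed.

Lemma le_sum_trans : transitive (@le_sum d P n).
Proof.
move=> v u w /andP[/eqP uv le_uv] /andP[vw /(le_trans le_uv)].
by rewrite /le_sum uv vw.
Qed.

Section Admissible.
Context {xs : seq (P * 'I_n)} (xsP : admissible xs).

Let mem_xs : xs =i carrier phi. Proof. by case: xsP. Qed.
Let xs_uniq : uniq xs. Proof. by case: xsP. Qed.

Let index_inj : {in carrier phi &, injective (index^~ xs)}.
Proof. by move=> u v; rewrite -!mem_xs => uxs vxs; apply: index_inj. Qed.

Let index_filter x y k : (y, k) \in carrier phi -> x <= y ->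
  (index (y, k) xs <= index (x, k) xs)%N.
Proof. by case: xsP => _ _ + _ _; apply. Qed.

Let index_le_sum u v : v \in carrier phi -> le_sum u v ->
  (index v xs <= index u xs)%N.
Proof.
case: u v => [x i] [y j] yC /andP[/= /eqP eij]; rewrite eij.
exact: index_filter.
Qed.

Let index_level u v : u \in carrier phi -> v \in carrier phi ->
  (u.2 < v.2)%N -> (index v xs < index u xs)%N.
Proof. by case: xsP => _ _ _ + _; apply. Qed.

Let index_chain (k : 'I_n) x i : (i <= k)%N -> (x, k) \in carrier phi ->
  ~~ (x <= phi i) -> (index (x, k) xs < index (phi i, k) xs)%N.
Proof. by case: xsP => _ _ _ _; apply. Qed.

(** * Segments of the ordering and their left modularity *)

Fact segment_subproof m :
  in_Tam phi [set u in carrier phi | (index u xs < m)%N].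
Proof.
apply/andP; split.
  apply/order_filterP; split=> [u|x y i]; first by rewrite !inE => /andP[].
  rewrite !inE => /andP[xi xm] xy yi; rewrite yi /=.
  by apply: leq_ltn_trans xm; apply: index_filter; rewrite ?inE.
apply/torclosedP => x i j ij; rewrite !inE /= => /andP[xi xm] _.
have xj : x <= phi j.
  by apply: le_trans xi _; apply: bot_chain_le; rewrite (ltnW ij) ltn_ord.
rewrite xj; apply: leq_ltn_trans (ltnW _) xm.
by apply: index_level; rewrite ?inE.
Qed.

Definition segment m : Tam phi := exist (in_Tam phi) _ (segment_subproof m).

Lemma in_segment m u :
  (u \in val (segment m)) = (u \in carrier phi) && (index u xs < m)%N.
Proof. by rewrite inE. Qed.

Lemma segment_level m u v : u \in val (segment m) -> v \in carrier phi ->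
  (u.2 < v.2)%N -> v \in val (segment m).
Proof.
rewrite !in_segment => /andP[uC um] vC uv; rewrite vC.
by apply: leq_trans um; apply/ltnW/index_level.
Qed.

Lemma segment_chain m i (k : 'I_n) x : (i <= k)%N ->
  (phi i, k) \in val (segment m) -> (x, k) \in carrier phi ->
  ~~ (x <= phi i) -> (x, k) \in val (segment m).
Proof.
rewrite !in_segment => ik /andP[_ im] xC nx; rewrite xC.
by apply: leq_trans im; apply/ltnW/index_chain.
Qed.

(* The elements that [b `|` segment m] adds to the union: [segment m] contains
   all levels above some [k] and none below [k], so these all lie in level [k].
   They form an up-closed set by construction. *)
Definition forced m b : {set P * 'I_n} :=
  [set v in carrier phi | [exists i : 'I_n, exists x : P,
     [&& (i < v.2)%N, (phi i.+1, v.2) \in val (segment m),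
         (x, i) \in val b & x <= v.1]]].

Lemma forcedP m b y (j : 'I_n) :
  reflect (y <= phi j /\ exists (i : 'I_n) x, [/\ (i < j)%N,
             (phi i.+1, j) \in val (segment m), (x, i) \in val b & x <= y])
          ((y, j) \in forced m b).
Proof.
rewrite !inE /=; apply: (iffP andP).
  case=> yj /existsP[i /existsP[x /and4P[ij Xi bx xy]]].
  by split=> //; exists i, x.
case=> yj [i [x [ij Xi bx xy]]]; split=> //.
by apply/existsP; exists i; apply/existsP; exists x; rewrite ij Xi bx.
Qed.

Fact join_segment_subproof m b :
  in_Tam phi (val b :|: val (segment m) :|: forced m b).
Proof.
set W := _ :|: _.
have WP v : reflect [\/ v \in val b, v \in val (segment m) | v \in forced m b]
                    (v \in W).
  by rewrite !in_setU -orbA; apply: or3P.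
apply/andP; split.
  apply/order_filterP; split=> [u /WP[/tam_carrier|/tam_carrier|]|x y i] //.
    by rewrite inE => /andP[]; rewrite inE.
  move=> Wx xy yi; apply/WP; case/WP: Wx => Wx.
  - by constructor 1; apply: tam_filter xy yi.
  - by constructor 2; apply: tam_filter xy yi.
  constructor 3; apply/forcedP; split=> //.
  case/forcedP: Wx => _ [k [z [ki Xk bz zx]]].
  by exists k, z; split=> //; apply: le_trans xy.
apply/torclosedP => y i j ij Wy Wi; apply/WP.
have jn := ltn_ord j.
(* An element of the segment on level [i] brings the whole higher level [j] with it, which settles
   every case except [(y, i)] in [b]. *)
have lvl v : v \in val (segment m) -> v.2 = i -> y <= phi j ->
    (y, j) \in val (segment m).
  by move=> Xv vi yj; apply: (segment_level Xv); rewrite ?inE // vi.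
have yj : y <= phi j.
  apply: (@le_trans _ _ (phi i)); last first.
    by apply: bot_chain_le; rewrite (ltnW ij).
  by case/WP: Wy => [/tam_carrier|/tam_carrier|/forcedP[]].
case/WP: Wy => [by_|/lvl Xy|/forcedP[_ [k [z [_ /lvl Xk _ _]]]]]; last first.
- by constructor 2; apply: Xk.
- by constructor 2; apply: Xy.
case/WP: Wi => [bi|Xi|/forcedP[_ [k [z [kj Xk bz zi]]]]].
- by constructor 1; apply: tam_torclosed ij by_ bi.
- by constructor 3; apply/forcedP; split=> //; exists i, y; split.
constructor 3; apply/forcedP; split=> //.
(* If [k <= i], then [(phi i.+1, j)] is already in the segment and [(y, i)] is a witness; if
   [i < k], torclosure of [b] lifts [y] to level [k]. *)
case: (leqP k i) => [ki|ik].
  exists i, y; split=> //; apply: tam_filter Xk _ _; apply: bot_chain_le.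
    by rewrite ltnS ki /=; apply: leq_ltn_trans jn.
  by rewrite ij.
exists k, y; split=> //; apply: (tam_torclosed ik by_).
by apply: tam_filter bz zi _; apply: bot_chain_le; rewrite ik ltn_ord.
Qed.

Lemma join_segment_sub m b :
  val (b `|` segment m) \subset val b :|: val (segment m) :|: forced m b.
Proof.
pose W : Tam phi := exist (in_Tam phi) _ (join_segment_subproof m b).
have : b `|` segment m <= W.
  by rewrite leUx !tam_leE /= -!setUA subsetUl setUCA subsetUl.
by rewrite tam_leE.
Qed.

(** Let [(y, j)] in [c] be forced by [(x, i)]. Unless [y <= phi i.+1], condition (ii) puts it in the
    segment, hence in [b]. Otherwise [(phi i.+1, j)] lies in [c] and in the segment, hence in [b],
    and torclosure of [b] gives [(x, j)]. *)
Lemma segment_cancel m b c :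
  b <= c -> c `&` segment m <= b -> c <= b `|` segment m -> c = b.
Proof.
rewrite !tam_leE tam_meetE => bc /subsetP cX cbX; apply/val_inj/eqP.
rewrite eqEsubset bc andbT; apply/subsetP => -[y j] cy.
have inb v : v \in val c -> v \in val (segment m) -> v \in val b.
  by move=> cv Xv; apply: cX; rewrite inE cv.
have := subsetP (subset_trans cbX (join_segment_sub m b)) _ cy.
rewrite !in_setU -orbA => /or3P[//|/(inb _ cy)//|].
move=> /forcedP[yj [i [x [ij Xi bx xy]]]].
have [yi|nyi] := boolP (y <= phi i.+1); last first.
  by apply: inb cy _; apply: segment_chain Xi _ nyi; rewrite ?inE.
have bi : (phi i.+1, j) \in val b.
  apply: inb Xi; apply: tam_filter cy yi _; apply: bot_chain_le.
  by rewrite ij ltn_ord.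
by apply: tam_filter xy yj; apply: tam_torclosed ij bx bi.
Qed.

Lemma segment_left_modular m : left_modular (segment m).
Proof. by apply: left_modular_cancel => b c; apply: segment_cancel. Qed.

Lemma index_onto m : (m < size xs)%N -> exists2 p, p \in xs & index p xs = m.
Proof.
case: xs xs_uniq => // u0 s us ms; exists (nth u0 (u0 :: s) m).
  exact: mem_nth.
exact: index_uniq.
Qed.

Lemma segment_covers m : (m < size xs)%N -> covers (segment m) (segment m.+1).
Proof.
move=> ms; have [p pxs pm] := index_onto ms.
have XX : segment m <= segment m.+1.
  rewrite tam_leE; apply/subsetP => u; rewrite !in_segment => /andP[-> /=].
  exact: leqW.
have XS u : u \in val (segment m.+1) -> u \notin val (segment m) -> u = p.
  rewrite !in_segment => /andP[uC um]; rewrite uC /= => num.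
  apply: index_inj => //.
    by rewrite -mem_xs.
  by apply/eqP; rewrite pm eqn_leq andbC leqNgt num.
have pX : p \in val (segment m.+1) by rewrite in_segment -mem_xs pxs pm ltnSn.
have npX : p \notin val (segment m) by rewrite in_segment pm ltnn andbF.
apply/andP; split.
  rewrite lt_neqAle XX andbT; apply/eqP => e; by rewrite e pX in npX.
apply/forallP => z; apply/negP; rewrite !lt_neqAle.
move=> /andP[/andP[/eqP neq1 le1] /andP[/eqP neq2 le2]].
rewrite !tam_leE in le1 le2.
case: (boolP (p \in val z)) => pz.
  apply: neq2; apply/val_inj/eqP; rewrite eqEsubset le2; apply/subsetP => u uX.
  have [uX'|/(XS u uX)->//] := boolP (u \in val (segment m)).
  exact: (subsetP le1).
apply: neq1; apply/val_inj/eqP; rewrite eqEsubset le1; apply/subsetP => u uz.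
apply: contraNT pz => nuX; rewrite -(XS u _ nuX) //; exact: (subsetP le2).
Qed.

Lemma segment_maximal_chain :
  maximal_chain \bot \top [seq segment m | m <- iota 0 (size xs).+1].
Proof.
have -> : (\bot : Tam phi) = segment 0.
  by apply/val_inj/setP => u; rewrite in_segment ltn0 andbF inE.
have -> : (\top : Tam phi) = segment (size xs).
  apply/val_inj/setP => u; rewrite in_segment tam_topE -mem_xs index_mem.
  by case: (u \in xs).
apply/maximal_chainP.
  rewrite tam_leE; apply/subsetP => u; by rewrite in_segment ltn0 andbF.
exists [seq segment m | m <- iota 1 (size xs)] => //; apply/andP; split.
  rewrite path_map; apply/(pathP 0%N) => m; rewrite size_iota => ms.
  rewrite -[0%N :: _]/(iota 0 (size xs).+1) !nth_iota //; last exact: ltnW.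
  exact: segment_covers.
rewrite last_map; apply/eqP; congr segment.
by rewrite (last_nth 0%N) size_iota -[0%N :: _]/(iota 0 (size xs).+1) nth_iota.
Qed.

Lemma admissible_left_modular : left_modular_lattice (Tam phi).
Proof.
exists [seq segment m | m <- iota 0 (size xs).+1].
split; first exact: segment_maximal_chain.
by move=> a /mapP[m _ ->]; apply: segment_left_modular.
Qed.

(** * First differences and the labels of covers *)

Lemma first_diff_le b c u :
  u \in val c :\: val b -> (first_diff xs b c <= (index u xs).+1)%N.
Proof.
move=> uD; rewrite ltnS leqNgt; apply/negP => /(before_find u).
rewrite nth_index /= ?uD // mem_xs; exact: diff_carrier uD.
Qed.

Lemma first_diff_gt b c m : (m <= size xs)%N ->
  (forall u, u \in val c :\: val b -> (m <= index u xs)%N) ->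
  (m < first_diff xs b c)%N.
Proof.
move=> ms H; rewrite ltnS leqNgt; apply/negP => lt_m.
have [p pxs pE] := index_onto (leq_trans lt_m ms).
have pD : p \in val c :\: val b.
  have := @nth_find _ p (mem (val c :\: val b)) xs.
  by rewrite -pE nth_index //; apply; rewrite has_find -pE index_mem.
by move: lt_m; rewrite -pE ltnNge H.
Qed.

Lemma first_diff_mem b c : b < c ->
  exists2 p, p \in val c :\: val b & first_diff xs b c = (index p xs).+1.
Proof.
rewrite lt_neqAle => /andP[nbc bc].
have : has (mem (val c :\: val b)) xs.
  apply/hasP; have /set0Pn[u uD] : val c :\: val b != set0.
    rewrite setD_eq0; apply: contra nbc => cb.
    by apply/eqP/val_inj/eqP; rewrite eqEsubset cb andbT.
  exists u => //; rewrite mem_xs.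
  exact: diff_carrier uD.
move=> hasD; have [p pxs pE] := index_onto (etrans (esym (has_find _ _)) hasD).
exists p; last by rewrite pE.
by have := nth_find p hasD; rewrite -pE nth_index.
Qed.

Lemma covers_omega b c : covers b c -> exists m,
  [/\ m \in val c :\: val b, forall u, u \in val c :\: val b -> le_sum u m
    & omega xs b c = (index m xs).+1].
Proof.
move=> bc; rewrite /omega; case: pickP => [m /andP[mD /forall_inP mmax]|none].
  by exists m.
have [m mD mmax] := covers_diff_max bc.
by have := none m; rewrite /= mD /=; have/forall_inP-> := mmax.
Qed.

(** Within a level larger elements come first, so the maximum of the difference is also its first
    element in [xs]. *)
Lemma omega_first_diff b c : covers b c -> omega xs b c = first_diff xs b c.
Proof.
move=> bc; have [m [mD mmax ->]] := covers_omega bc.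
apply/eqP; rewrite eqn_leq first_diff_le // andbT.
have mxs : m \in xs.
  rewrite mem_xs.
  exact: diff_carrier mD.
apply: first_diff_gt => [|u uD]; first by rewrite ltnW // index_mem.
by apply: index_le_sum (mmax u uD); rewrite -mem_xs.
Qed.

(** With [p] the first new element, [X] meets [c] outside [b] in [p] alone, so [a] is the least
    element above [b] containing [p]. Other atoms below [c] therefore miss [p]. *)
Lemma omega_atom b c : b < c -> exists a,
  [/\ covers b a, a <= c, (first_diff xs b c < first_diff xs a c)%N
    & forall a', covers b a' -> a' <= c -> a' <> a ->
        (first_diff xs b c < first_diff xs b a')%N].
Proof.
move=> ltbc; have [p pD ip] := first_diff_mem ltbc.
have /andP[npb pc] : (p \notin val b) && (p \in val c) by rewrite inE in pD.
have pC := subsetP (tam_sub_carrier c) p pc.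
have isz : (index p xs < size xs)%N by rewrite index_mem mem_xs.
have bc := ltW ltbc.
pose X := segment (index p xs).+1; pose Y := X `&` c; pose a := b `|` Y.
have indexD u : u \in val c :\: val b -> u <> p -> (index p xs < index u xs)%N.
  move=> uD np; have := first_diff_le uD; rewrite ip ltnS leq_eqVlt.
  case/predU1P=> // e; case: np; apply/esym/index_inj => //.
  exact: diff_carrier uD.
have new u : u \in val X -> u \in val c -> u \notin val b -> u = p.
  rewrite in_segment => /andP[_ ui] uc nub; apply/eqP/negPn/negP => /eqP np.
  by have := indexD u _ np; rewrite inE nub uc ltnNge -ltnS ui; move/(_ isT).
have ba : b <= a by apply: leUl.
have Ya : Y <= a by apply: leUr.
have ac : a <= c by rewrite leUx bc leIr.
have pa : p \in val a.
  apply: (subsetP Ya); rewrite tam_meetE inE pc in_segment pC ltnSn //.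
have Yle e : b <= e -> p \in val e -> a <= e.
  move=> be pe; rewrite leUx be tam_leE; apply/subsetP => u.
  rewrite tam_meetE inE => /andP[uX uc].
  have [/(subsetP be)//|nub] := boolP (u \in val b).
  by rewrite (new u).
exists a; split=> //.
- apply/andP; split.
    by rewrite lt_neqAle ba andbT; apply: contra npb => /eqP->.
  apply/forallP => e; apply/negP => /andP[be ea].
  have [pe|npe] := boolP (p \in val e).
    by have := lt_le_trans ea (Yle e (ltW be) pe); rewrite ltxx.
  (* Without [p], the meet of [e] with the segment stays inside [b], so cancellation applies. *)
  have eb : e = b.
    apply: (@segment_cancel (index p xs).+1) (ltW be) _ _.
      rewrite tam_leE; apply/subsetP => u.
      rewrite tam_meetE inE => /andP[ue uX].
      apply: contraNT npe => nub; rewrite -(new u) //.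
      by apply: subsetP ue; apply: le_trans (ltW ea) ac.
    by apply: le_trans (ltW ea) _; apply: leU2 => //; apply: leIl.
  by rewrite eb ltxx in be.
- rewrite ip; apply: first_diff_gt => // u; rewrite inE => /andP[nua uc].
  apply: indexD; last by move=> e; rewrite e pa in nua.
  by rewrite inE uc andbT; apply: contra nua; apply: (subsetP ba).
move=> a' ba' a'c na'; rewrite ip; apply: first_diff_gt => // u.
rewrite inE => /andP[nub ua']; apply: indexD.
  by rewrite inE nub; apply: (subsetP a'c).
move=> e; apply: na'; apply/esym/(covers_eq ba').
  by rewrite lt_neqAle ba andbT; apply: contra npb => /eqP->.
by apply: Yle; [case/andP: ba' => /ltW | rewrite -e].
Qed.

Lemma omega_first_label : first_label (omega xs) (first_diff xs).
Proof.
split; [exact: omega_first_diff | exact: first_diff_min | exact: omega_atom].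
Qed.

(** * Uniqueness of decreasing chains *)

Definition tops b c : {set P * 'I_n} :=
  [set z in val c :\: val b |
    [forall w in val c :\: val b, le_sum z w ==> (w == z)]].

Lemma topsP b c z :
  reflect (z \in val c :\: val b /\
           forall w, w \in val c :\: val b -> le_sum z w -> w = z)
          (z \in tops b c).
Proof.
rewrite [z \in tops _ _]inE; apply: (iffP andP).
  case=> zD /forall_inP zmax.
  by split=> // w wD zw; apply/eqP; apply: (implyP (zmax w wD)).
case=> zD zmax; split=> //; apply/forall_inP => w wD; apply/implyP => zw.
by apply/eqP/zmax.
Qed.

(** Induction along the chain: the first step adds to the maximal elements of the rest exactly the
    maximum [m] of its own difference. *)
Lemma decreasing_labels b s : path (@covers _ (Tam phi)) b s ->
  sorted geq (pairmap (omega xs) b s) ->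
  uniq (pairmap (omega xs) b s) /\
  pairmap (omega xs) b s =i [seq (index z xs).+1 | z in tops b (last b s)].
Proof.
elim: s b => [|a s IH] b.
  move=> _ _; split=> // l; apply/esym/negbTE/imageP => -[z].
  by rewrite inE setDv inE.
move=> /= /andP[ba pth] dec.
have [u_s s_tops] := IH a pth (path_sorted dec).
set c := last a s in s_tops *.
have {}dec z : z \in tops a c -> ((index z xs).+1 <= omega xs b a)%N.
  move=> zt; have /allP := order_path_min (rev_trans leq_trans) dec; apply.
  by rewrite s_tops; apply: image_f.
have ac : a <= c := path_covers_le pth.
have ba' : b <= a by case/andP: ba => /ltW.
have [m [mD mmax om]] := covers_omega ba; rewrite om in dec *.
have [nbm am] : m \notin val b /\ m \in val a by apply/andP; rewrite inE in mD.
have neq_m z : z \in tops a c -> index z xs <> index m xs.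
  move=> /topsP[zD _] e; have ezm : z = m.
    by apply: index_inj e; [exact: diff_carrier zD | exact: diff_carrier mD].
  by move: zD; rewrite ezm inE am.
have sub_bc w : w \in val c :\: val a -> w \in val c :\: val b.
  rewrite !inE => /andP[wa ->]; rewrite andbT (contra _ wa) //.
  exact: (subsetP ba').
have mc : m \in val c :\: val b by rewrite inE nbm (subsetP ac).
have m_top : m \in tops b c.
  apply/topsP; split=> // w wD mw; apply: (le_sum_anti _ mw); apply: mmax.
  have := wD; rewrite !inE => /andP[-> _]; apply: (le_sum_filter am mw).
  exact: diff_carrier wD.
split.
  by rewrite /= u_s andbT s_tops; apply/imageP => -[z /neq_m nzm [/esym]].
move=> l; rewrite inE s_tops; apply/predU1P/imageP.
  case=> [->|/imageP[z zt ->]]; first by exists m.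
  exists z => //; have [zD zmax] := topsP _ _ _ zt.
  apply/topsP; split=> [|w wD zw]; first exact: sub_bc.
  have [wa|nwa] := boolP (w \in val a); last first.
    by apply: zmax zw; move: wD; rewrite !inE nwa => /andP[].
  (* Here [w] in [a] gives [z <= w <= m], so [m] comes no later than [z]; decreasing labels give the
     converse, whence [z = m], although [m] lies in [a] and [z] does not. *)
  case: (neq_m z zt); apply/eqP; rewrite eqn_leq -ltnS dec //=.
  apply: index_le_sum; first exact: diff_carrier mD.
  apply: le_sum_trans zw (mmax w _).
  by move: wD; rewrite !inE wa => /andP[->].
case=> z /topsP[zD zmax] ->.
have [za|nza] := boolP (z \in val a).
  left; rewrite (zmax m) //; apply: mmax.
  by move: zD; rewrite !inE za => /andP[->].
right; apply: image_f; apply/topsP; split.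
  by move: zD; rewrite !inE nza => /andP[].
by move=> w /sub_bc wD; apply: zmax.
Qed.

(** Equal labels mean a common maximum [m]; the meet of [b] and [c] contains it, so it lies strictly
    above [a] and equals both. *)
Lemma omega_inj a b c : covers a b -> covers a c ->
  omega xs a b = omega xs a c -> b = c.
Proof.
move=> ab ac; have [m [mb _ ->]] := covers_omega ab.
have [m' [mc _ ->]] := covers_omega ac.
have mC := diff_carrier mb; have mC' := diff_carrier mc.
case=> /index_inj e; rewrite -e // {e} in mc.
have abc : a < b `&` c.
  have [/andP[ab' _] /andP[ac' _]] := (ab, ac).
  rewrite lt_neqAle lexI (ltW ab') (ltW ac') !andbT; apply/eqP => e.
  have : m \in val (b `&` c).
    by move: mb mc; rewrite !inE => /andP[_ ->] /andP[].
  by rewrite -e; move: mb; rewrite inE => /andP[/negbTE->].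
by rewrite -(covers_eq ab abc (leIl _ _)) (covers_eq ac abc (leIr _ _)).
Qed.

Lemma omega_word_inj b s t : path (@covers _ (Tam phi)) b s ->
  path (@covers _ (Tam phi)) b t ->
  pairmap (omega xs) b s = pairmap (omega xs) b t -> s = t.
Proof.
elim: s b t => [|a s IH] b [|a' t] //= /andP[ba ps] /andP[ba' pt] [eqa eqs].
rewrite -(omega_inj ba ba' eqa) in pt eqs *.
by rewrite (IH a t).
Qed.

Lemma decreasing_uniq b c s t : path (@covers _ (Tam phi)) b s ->
  path (@covers _ (Tam phi)) b t -> last b s = c -> last b t = c ->
  sorted geq (pairmap (omega xs) b s) -> sorted geq (pairmap (omega xs) b t) ->
  s = t.
Proof.
move=> ps pt ls lt decs dect; apply: (omega_word_inj ps pt).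
have [us ms] := decreasing_labels ps decs.
have [ut mt] := decreasing_labels pt dect.
apply: (sorted_eq (rev_trans leq_trans) _ decs dect).
  by move=> i j; rewrite andbC => /anti_leq.
by apply: uniq_perm => // l; rewrite ms mt ls lt.
Qed.

End Admissible.

(** * Admissible orderings from linear extensions, and their existence *)

Lemma enum_admissible (prec : rel (P * 'I_n)) xs :
  linear_extension (carrier phi) (@le_prod d P n) prec ->
  decreasing_enum (carrier phi) prec xs ->
  (forall (x y : P) (i j : 'I_n),
     (x, j) \in carrier phi -> (y, i) \in carrier phi -> (i < j)%N ->
     prec (y, i) (x, j)) ->
  (forall (k : 'I_n) (x : P) (i : nat),
     (x, k) \in carrier phi -> (i <= k)%N ->
     ~~ le_sum (x, k) (chain_elt phi i k) -> prec (chain_elt phi i k) (x, k)) ->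
  admissible xs.
Proof.
move=> [pirr ptrans _ pext] [mem_xs srt] plvl pchain.
have tr : {in xs & &, transitive (fun u v => prec v u)}.
  by move=> v u w; rewrite !mem_xs => vC uC wC uv vw; apply: ptrans vw uv.
have prec_index u v : u \in carrier phi -> v \in carrier phi -> prec u v ->
    (index v xs < index u xs)%N.
  rewrite -!mem_xs => ux vx uv; have := pirr u; rewrite -mem_xs => /(_ ux).
  rewrite ltnNge; apply: contraNN; rewrite leq_eqVlt => /predU1P[|].
    by move/index_inj => e; rewrite {2}e.
  move/(sorted_ltn_index_in tr srt _ _ ux vx) => vu.
  by apply: (ptrans v); rewrite -?mem_xs.
split=> //.
- apply: (sorted_uniq_in tr _ srt) => u; rewrite mem_xs => uC.
  exact/negbTE/pirr.
- move=> x y k yC xy; case: (eqVneq x y) => [->//|/eqP nxy].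
  have xC : (x, k) \in carrier phi by move: yC; rewrite !inE; apply: le_trans.
  apply/ltnW/prec_index => //; apply: pext => //; last by case.
  by rewrite /le_prod /= xy leqnn.
- by move=> [x i] [y j] xC yC ij; apply: prec_index => //; apply: plvl.
move=> k x i ik xC nxi; apply: prec_index => //; first exact: carrier_chain.
have := pchain k x (k - i)%N xC (leq_subr _ _).
by rewrite /chain_elt subKn // /le_sum /= eqxx; apply.
Qed.

(* Conditions (i) and (ii) order the elements first by level, then by the
   number of chain elements not above them. *)
Definition enum_key u : seqlexi nat :=
  [:: (u.2 : nat); #|[set i : 'I_n | ~~ (u.1 <= phi i)]|;
      #|[set z | (z <= u.1)%O]|; (enum_rank u.1 : nat)].

Lemma enum_key_inj : injective enum_key.
Proof.
by move=> [x i] [y j] [/val_inj-> _ _ /val_inj/enum_rank_inj /= ->].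
Qed.

Let key_prec : rel (P * 'I_n) := fun u v => enum_key u < enum_key v.

Lemma key_prec_linear :
  linear_extension (carrier phi) (@le_prod d P n) key_prec.
Proof.
split=> [u _|v u w _ _ _|u v _ _ nuv|u v _ _ /andP[le1 le2] nuv].
- by rewrite /key_prec ltxx.
- exact: lt_trans.
- by apply/orP/lt_total/eqP => /enum_key_inj.
rewrite /key_prec /enum_key ltxi_cons leEnat le2 /=; apply/implyP => le2'.
have sub1 : [set i : 'I_n | ~~ (u.1 <= phi i)] \subset
            [set i : 'I_n | ~~ (v.1 <= phi i)].
  by apply/subsetP => i; rewrite !inE; apply/contra/le_trans.
(* The third entry of the key decides ties of the first two: on one level it grows strictly between
   distinct comparable elements. *)
have sub2 : [set z | (z <= u.1)%O] \proper [set z | (z <= v.1)%O].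
  apply/properP; split.
    by apply/subsetP => z; rewrite !inE => /le_trans; apply.
  exists v.1; rewrite !inE ?lexx //; apply/negP => le1'; apply: nuv.
  case: u v le1 le2 le2' le1' {sub1} => [x i] [y j] /= xy ij ji yx.
  congr (_, _); first by apply/le_anti; rewrite xy.
  by apply/val_inj/anti_leq; rewrite ij.
rewrite ltxi_cons leEnat (subset_leq_card sub1) /=; apply/implyP => _.
by rewrite ltxi_cons leEnat ltnW ?proper_card //= leqNgt proper_card.
Qed.

Lemma exists_admissible : exists xs, admissible xs.
Proof.
pose s := sort (relpre enum_key <=%O) (enum (carrier phi)).
exists (rev s); apply: (enum_admissible key_prec_linear).
- split=> [u|]; first by rewrite mem_rev mem_sort mem_enum.
  rewrite rev_sorted -(@sorted_map _ _ enum_key) -sort_map sort_lt_sorted.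
  by rewrite (map_inj_uniq enum_key_inj) enum_uniq.
- move=> x y i j _ _ ij.
  by rewrite /key_prec ltxi_cons leEnat /= ltnW //= leqNgt ij.
move=> k x i xC ik; rewrite /le_sum /chain_elt /= eqxx /= => nxi.
rewrite /key_prec !ltxi_cons leEnat leqnn /=.
set A := [set _ | _]; set B := [set _ | _].
(* If [x <= phi j] with [j < k - i], then [x <= phi (k - i)], which is excluded; the index [k - i]
   itself makes the inclusion strict. *)
suff AB : A \proper B by rewrite ltnW ?proper_card //= leqNgt proper_card.
have kin : (k - i < n)%N by apply: leq_ltn_trans (leq_subr _ _) (ltn_ord k).
apply/properP; split.
  apply/subsetP => j; rewrite !inE; apply: contra => xj.
  apply: bot_chain_le; rewrite ltn_ord andbT; rewrite leqNgt.
  apply: contra nxi => jki; apply: le_trans xj _.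
  by apply: bot_chain_le; rewrite ltnW.
by exists (Ordinal kin); rewrite !inE /= ?lexx.
Qed.

End Segments.

Theorem theorem4p14 (d : Order.disp_t) (P : finBPOrderType d) (n : nat)
    (phi : bot_chain P n) :
  left_modular_lattice (Tam phi)
  /\
  (forall (prec : rel (P * 'I_n)) (xs : seq (P * 'I_n)),
     linear_extension (carrier phi) (@le_prod d P n) prec ->
     decreasing_enum (carrier phi) prec xs ->
     (forall (x y : P) (i j : 'I_n),
        (x, j) \in carrier phi -> (y, i) \in carrier phi -> (i < j)%N ->
        prec (y, i) (x, j)) ->
     (forall (k : 'I_n) (x : P) (i : nat),
        (x, k) \in carrier phi -> (i <= k)%N ->
        ~~ le_sum (x, k) (chain_elt phi i k) ->
        prec (chain_elt phi i k) (x, k)) ->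
     EL_labelling (@omega d P n phi xs)
     /\
     (forall x y : Tam phi, x <= y ->
        forall s t : seq (Tam phi),
          maximal_chain x y s -> maximal_chain x y t ->
          decreasing_chain (omega xs) s -> decreasing_chain (omega xs) t ->
          s = t))
  /\
  (forall x y : Tam phi, x <= y ->
     mobius x y \in [:: (-1)%R; 0%R; 1%R]).
Proof.
have [xs xsP] := @exists_admissible d P n phi.
split; first exact: admissible_left_modular xsP.
split=> [prec ys ext enum lvl chain|x y xy]; last first.
  apply: (mobius_small (omega_first_label xsP)) xy.
  exact: decreasing_uniq xsP.
have ysP := enum_admissible ext enum lvl chain.
split; first exact: first_label_EL (omega_first_label ysP).
move=> x y xy s t /(maximal_chainP _ xy)[s' -> /andP[ps /eqP ls]].
move=> /(maximal_chainP _ xy)[t' -> /andP[pt /eqP lt]] decs dect.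
by rewrite (decreasing_uniq ysP ps pt ls lt).
Qed.
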